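(* Let $G=(V,E)$ be a finite connected graph with $N$ vertices and let $\epsilon\in[0,1]$. Then \[ \mu_\epsilon(G)\ \le\ \min_{\text{choices}}\bigl(\min(\omega(G),\lceil\epsilon^{-1}\rceil)+\mu_\epsilon(\pi(G))\bigr)\ \le\ \min_{\text{choices}}\ \sum_{i=0}^{N-1}\min\bigl(\omega(\pi^i(G)),\lceil\epsilon^{-1}\rceil\bigr), \] where in the middle expression the minimum is over all choices of a largest clique $W$ of $G$ (which determines $\pi(G)$), and in the last expression the minimum is over all possible choices of the sequence of subgraphs $G=\pi^0(G),\pi(G),\pi^2(G),\dots,\pi^{N-1}(G)$.
   Context: Graphs are simple and undirected. For a finite (possibly disconnected or empty) graph $G=(V,E)$ and a confidence threshold $\epsilon\in[0,1]$, an absorbing state (static configuration) is a map $\eta:V\to[0,1]$ such that for each edge $(x,y)\in E$ one has $|\eta(x)-\eta(y)|>\epsilon$ or $\eta(x)=\eta(y)$. The $\epsilon$-opinion index $\mu_\epsilon(G)$ is the maximum, over all absorbing states $\eta$, of the number of distinct opinions $\operatorname{card}\{\eta(x):x\in V\}$ (so $\mu_\epsilon(\varnothing)=0$). A clique is a set of pairwise adjacent vertices. For a finite graph $G$, let $W\subset V$ be a largest clique (clique of maximum cardinality); $\omega(G)$ denotes the number of vertices in $W$ and $\pi(G)$ denotes the subgraph of $G$ induced by $V\setminus W$. If there are several largest cliques, $\pi(G)$ depends on the choice of $W$. A sequence $\pi^0(G)=G$, $\pi^{i+1}(G)=\pi(\pi^i(G))$ is obtained by choosing a largest clique at each stage;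 $\omega(\varnothing)=0$ and $\pi(\varnothing)=\varnothing$. $\lceil a\rceil$ denotes the least integer not less than $a$, and $\lceil\epsilon^{-1}\rceil=+\infty$ if $\epsilon=0$. *)

(* Defs.v *)
From HB Require Import structures.
From mathcomp Require Import all_boot all_order all_algebra.
From mathcomp Require Import boolp reals constructive_ereal.

Set Implicit Arguments.
Unset Strict Implicit.
Unset Printing Implicit Defensive.
Import Order.TTheory GRing.Theory Num.Theory.
Local Open Scope ring_scope.

(* A finite simple graph is a symmetric irreflexive relation [e] on a finite
   type [T].  Its induced subgraphs, the only other graphs needed, are given by
   their vertex sets [A : {set T}]; the whole graph is [[set: T]]. *)

Section Graph.
Variables (T : finType) (e : rel T).
Implicit Types A B W : {set T}.

Definition connected_graph : Prop := forall x y : T, connect e x y.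

Definition clique A W : bool :=
  (W \subset A) && [forall x in W, forall y in W, (x != y) ==> e x y].

Definition clique_number A : nat := \max_(W | clique A W) #|W|.

Definition largest_clique A W : bool :=
  clique A W && [forall W', clique A W' ==> (#|W'| <= #|W|)%N].

(* [B] is a possible value of pi(A); since set0 is the only clique of set0,
   this gives pi(set0) = set0. *)
Definition is_pi A B : bool :=
  [exists W, largest_clique A W && (B == A :\: W)].

(* s is a possible sequence pi^0(G), ..., pi^(n-1)(G). *)
Definition is_pi_seq (n : nat) (s : {ffun 'I_n -> {set T}}) : bool :=
  [forall i, (val i == 0%N) ==> (s i == [set: T])] &&
  [forall i, forall j, (val j == (val i).+1) ==> is_pi (s i) (s j)].

(* This and [pi_seq_exists] show that the minima over all choices, taken in
   \bar R with default +oo, range over nonempty families. *)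
Lemma largest_clique_exists A : exists W, largest_clique A W.
Proof.
have c0 : clique A set0.
  by rewrite /clique sub0set; apply/forallP => x; rewrite inE.
case: (arg_maxnP (fun W : {set T} => #|W|) c0) => W cW maxW.
exists W; rewrite /largest_clique cW; apply/forallP => W'.
exact/implyP/maxW.
Qed.

Lemma pi_seq_exists n : exists s : {ffun 'I_n -> {set T}}, is_pi_seq s.
Proof.
pose f A := A :\: xchoose (largest_clique_exists A).
exists [ffun i : 'I_n => iter i f [set: T]]; apply/andP; split.
  by apply/forallP => i; apply/implyP => /eqP i0; rewrite ffunE i0.
apply/forallP => i; apply/forallP => j; apply/implyP => /eqP ji.
rewrite !ffunE ji iterS; apply/existsP.
by exists (xchoose (largest_clique_exists (iter i f [set: T])));
  rewrite (xchooseP (largest_clique_exists _)) /f eqxx.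
Qed.

End Graph.

Section Opinions.
Variables (R : realType) (T : finType) (e : rel T).
Implicit Types (A : {set T}) (eps : R) (eta : T -> R).

(* Only the restriction of [eta] to [A] matters, here and in [num_opinions]. *)
Definition absorbing eps A eta : Prop :=
  (forall x, x \in A -> 0 <= eta x <= 1) /\
  (forall x y, x \in A -> y \in A -> e x y ->
     eps < `|eta x - eta y| \/ eta x = eta y).

Definition num_opinions A eta : nat := size (undup [seq eta x | x in A]).

(* The number of opinions never exceeds #|A|, so bounding the range of [k]
   excludes nothing. *)
Definition opinion_index eps A : nat :=
  \max_(k < #|A|.+1 |
        `[< exists eta, absorbing eps A eta /\ num_opinions A eta = k >]) k.

Definition ceil_inv eps : \bar R :=
  if eps == 0 then +oo%E else ((Num.ceil eps^-1)%:~R)%:E.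

Definition capped_clique_number eps A : \bar R :=
  Order.min ((clique_number e A)%:R)%:E (ceil_inv eps).

End Opinions.

(* Main.v *)
Require Import Defs.
From mathcomp Require Import all_boot all_order all_algebra.
From mathcomp Require Import boolp reals constructive_ereal.

(** Fix a largest clique W of A and an absorbing state on A.  The opinions held
    on A are those held on W together with those held on A \ W, and the state
    stays absorbing on A \ W, so at most mu(A \ W) opinions occur there.  On W
    any two distinct opinions are more than eps apart, because their holders
    are adjacent.  There are therefore at most #|W| of them, and, when eps > 0,
    also at most ceil(1/eps): listed in increasing order, k opinions of [0, 1]
    span a length greater than (k - 1) * eps as soon as k > 1.  This gives the
    one-step bound [opinion_index_le_pi], which is the first inequality.

    For the second inequality, each sequence of choices is matched with the
    largest clique W removed at its first stage, and the one-step bound is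
    iterated along the rest of the sequence ([pi_path_bound]).  Each stage
    removes at least one vertex from a nonempty graph, so after N stages nothing
    is left and the iteration leaves no remainder.  The one-step
    bound has to cover arbitrary vertex subsets A, since removing a clique may
    disconnect the graph. *)

Set Implicit Arguments.
Unset Strict Implicit.
Unset Printing Implicit Defensive.
Import Order.TTheory GRing.Theory Num.Theory.
Local Open Scope ring_scope.

(** * Separated points of the unit interval *)

Section Separated.
Variables (R : realType) (eps : R).

Lemma path_gap_span (x : R) (l : seq R) :
  path (fun y z => y + eps < z) x l -> x + (size l)%:R * eps <= last x l.
Proof.
elim: l x => [|y l IHl] x /=; first by rewrite mul0r addr0.
case/andP=> xy /IHl; apply: le_trans.
by rewrite -addn1 natrD mulrDl mul1r [_ + eps]addrC addrA lerD2r ltW.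
Qed.

(** Sorting turns pairwise separation into gaps between consecutive points. *)
Lemma size_separated_lt (s : seq R) : 0 < eps -> uniq s ->
  {in s, forall x, 0 <= x <= 1} ->
  {in s &, forall x y, x != y -> eps < `|x - y|} ->
  (size s).-1%:R * eps < 1.
Proof.
move=> eps0 s_uniq s01 s_sep; rewrite -(size_sort <=%R).
have mem_s y : (y \in sort <=%R s) = (y \in s) by rewrite mem_sort.
have gap : sorted (fun y z => y + eps < z) (sort <=%R s).
  have : sorted <%R (sort <=%R s) by rewrite sort_lt_sorted.
  apply: sub_in_sorted (allss _) => y z; rewrite !mem_s => ys zs yz.
  have := s_sep _ _ ys zs; rewrite lt_eqF // => /(_ isT).
  by rewrite distrC gtr0_norm ?subr_gt0 // ltrBrDl.
case: (sort _ _) mem_s gap => [|x [|y l]] mem_s /=; rewrite ?mul0r ?ltr01 //.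
case/andP=> xy /path_gap_span yl.
have x0 : 0 <= x by have /s01/andP[] : x \in s by rewrite -mem_s mem_head.
have l1 : last y l <= 1.
  by have /s01/andP[] : last y l \in s by rewrite -mem_s inE mem_last orbT.
rewrite -addn1 natrD mulrDl mul1r (lt_le_trans _ l1) // (lt_le_trans _ yl) //.
by rewrite addrC ltrD2r (le_lt_trans _ xy) // lerDr.
Qed.

Lemma size_separated_ceil_inv (s : seq R) : 0 <= eps -> uniq s ->
  {in s, forall x, 0 <= x <= 1} ->
  {in s &, forall x y, x != y -> eps < `|x - y|} ->
  (((size s)%:R)%:E <= ceil_inv eps)%E.
Proof.
rewrite /ceil_inv le_eqVlt eq_sym => /orP[->|eps0]; first by rewrite leey.
move=> s_uniq s01 s_sep; rewrite gt_eqF // lee_fin.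
have lt1 := size_separated_lt eps0 s_uniq s01 s_sep.
rewrite pmulrn ler_int.
have : ((size s).-1%:Z < Num.ceil eps^-1)%R.
  by rewrite ceil_gt_int -pmulrn -[eps^-1]mul1r ltr_pdivlMr.
rewrite -lezD1; apply: le_trans.
by rewrite -PoszD addn1 lez_nat leqSpred.
Qed.

End Separated.

(** * Largest cliques *)

Section Cliques.
Variables (T : finType) (e : rel T).
Implicit Types A B W : {set T}.

Lemma cliqueP A W : reflect (W \subset A /\
  {in W &, forall x y, x != y -> e x y}) (clique e A W).
Proof.
apply: (iffP andP) => -[WA W_adj]; split=> //.
  by move=> x y xW yW; move/forall_inP/(_ x xW)/forall_inP/(_ y yW)/implyP: W_adj.
apply/forall_inP => x xW; apply/forall_inP => y yW; apply/implyP.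
exact: W_adj.
Qed.

Lemma largest_clique_neq0 A W :
  largest_clique e A W -> A != set0 -> W != set0.
Proof.
case/andP=> _ /forallP maxW /set0Pn[x xA].
have /(implyP (maxW _)) : clique e A [set x].
  apply/cliqueP; rewrite sub1set; split=> // y z /set1P-> /set1P->.
  by rewrite eqxx.
by rewrite cards1 card_gt0.
Qed.

Lemma card_largest_cliqueD A W n :
  largest_clique e A W -> (#|A| <= n.+1)%N -> (#|A :\: W| <= n)%N.
Proof.
have [-> _ _|A0 lW] := eqVneq A set0; first by rewrite set0D cards0.
have /andP[/cliqueP[WA _] _] := lW.
move=> A_le; rewrite -ltnS (leq_trans _ A_le) //; apply: proper_card.
have /set0Pn[x xW] := largest_clique_neq0 lW A0.
apply/properP; split; first exact: subsetDl.
by exists x; rewrite ?inE ?xW // (subsetP WA).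
Qed.

Lemma is_piP A B :
  reflect (exists2 W, largest_clique e A W & B = A :\: W) (is_pi e A B).
Proof.
apply: (iffP existsP) => [[W /andP[lW /eqP->]]|[W lW ->]]; exists W => //.
by rewrite lW eqxx.
Qed.

(** A sequence of choices, seen as a list, is a path of the relation pi: in
    this form the bound along it can be proved by induction on the list. *)
Lemma is_pi_seq_sorted n (s : {ffun 'I_n -> {set T}}) :
  is_pi_seq e s -> sorted (is_pi e) (codom s).
Proof.
case/andP=> _ /forallP s_pi; apply/(sortedP set0) => i.
rewrite size_codom card_ord => ltin.
have nth_s (j : 'I_n) : nth set0 (codom s) j = s j.
  by rewrite (nth_map j) ?size_enum_ord ?nth_ord_enum.
rewrite (nth_s (Ordinal ltin)) (nth_s (Ordinal (ltnW ltin))).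
exact: (implyP (forallP (s_pi _) _)).
Qed.

End Cliques.

(** * Removing one clique *)

Section Index.
Variables (R : realType) (T : finType) (e : rel T) (eps : R).
Implicit Types (A W : {set T}) (eta : T -> R).

Lemma absorbingS A W eta :
  W \subset A -> absorbing e eps A eta -> absorbing e eps W eta.
Proof.
move=> /subsetP WA [eta01 eta_abs]; split=> [x /WA|x y /WA xA /WA].
  exact: eta01.
exact: eta_abs.
Qed.

Lemma num_opinions_le_card A eta : (num_opinions A eta <= #|A|)%N.
Proof. by rewrite (leq_trans (size_undup _)) // size_image. Qed.

Lemma num_opinionsD A W eta :
  (num_opinions A eta <= num_opinions W eta + num_opinions (A :\: W) eta)%N.
Proof.
rewrite -size_cat; apply: uniq_leq_size; first exact: undup_uniq.
move=> r; rewrite mem_cat !mem_undup => /imageP[x xA ->].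
have [xW|xNW] := boolP (x \in W); first by rewrite image_f.
by rewrite (@image_f _ _ eta (mem (A :\: W))) ?orbT // inE xNW.
Qed.

Lemma num_opinions_le_index A eta :
  absorbing e eps A eta -> (num_opinions A eta <= opinion_index e eps A)%N.
Proof.
move=> eta_abs; have lt_k := num_opinions_le_card A eta.
rewrite /opinion_index; apply: (bigop.bigmax_sup (Ordinal (lt_k : (_ < _.+1)%N))) => //.
by apply/asboolP; exists eta.
Qed.

(** Constant states are absorbing, so the maximum is over a nonempty family. *)
Lemma opinion_index_attained A : exists2 eta,
  absorbing e eps A eta & num_opinions A eta = opinion_index e eps A.
Proof.
have abs0 : absorbing e eps A (fun=> 0).
  by split=> [x _|x y _ _ _]; [rewrite lexx ler01 | right].
have lt_k := num_opinions_le_card A (fun=> 0 : R).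
pose P := [pred k : 'I_#|A|.+1 |
  `[< exists eta, absorbing e eps A eta /\ num_opinions A eta = k >]].
have P_gt0 : (0 < #|P|)%N.
  apply/card_gt0P; exists (Ordinal (lt_k : (_ < _.+1)%N)).
  by apply/asboolP; exists (fun=> 0).
have [k /asboolP[eta [eta_abs eta_k]] mu_k] := eq_bigmax_cond (@nat_of_ord _) P_gt0.
by exists eta => //; rewrite eta_k /opinion_index -mu_k.
Qed.

Lemma num_opinions_clique A W eta : 0 <= eps -> clique e A W ->
  absorbing e eps A eta ->
  (((num_opinions W eta)%:R)%:E <= capped_clique_number e eps A)%E.
Proof.
move=> eps0 cW eta_abs; rewrite le_min; apply/andP; split.
  rewrite lee_fin ler_nat (leq_trans (num_opinions_le_card _ _)) //.
  exact: leq_bigmax_cond.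
have [WA W_adj] := cliqueP _ _ _ cW.
have [W01 W_sep] := absorbingS WA eta_abs.
apply: size_separated_ceil_inv; rewrite ?undup_uniq // => r.
  by rewrite mem_undup => /imageP[x xW ->]; apply: W01.
move=> r'; rewrite !mem_undup => /imageP[x xW ->] /imageP[y yW ->] neq.
have xy : x != y by apply: contraNneq neq => ->.
case: (W_sep x y xW yW (W_adj x y xW yW xy)) => // eq_xy.
by rewrite eq_xy eqxx in neq.
Qed.

Lemma opinion_index_le_pi A W : 0 <= eps -> largest_clique e A W ->
  (((opinion_index e eps A)%:R)%:E <=
   capped_clique_number e eps A + ((opinion_index e eps (A :\: W))%:R)%:E)%E.
Proof.
move=> eps0 /andP[cW _]; have [eta eta_abs <-] := opinion_index_attained A.
apply: (@le_trans _ _ (((num_opinions W eta)%:R)%:E +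
                       ((num_opinions (A :\: W) eta)%:R)%:E)%E).
  by rewrite -EFinD lee_fin -natrD ler_nat num_opinionsD.
apply: leeD; first exact: num_opinions_clique.
rewrite lee_fin ler_nat num_opinions_le_index //.
by apply: absorbingS eta_abs; apply: subsetDl.
Qed.

Lemma opinion_index0 : opinion_index e eps set0 = 0%N.
Proof.
have [eta _ <-] := opinion_index_attained set0.
by apply/eqP; rewrite -leqn0 -(cards0 T) num_opinions_le_card.
Qed.

(** * Removing cliques until nothing is left *)

(** The conclusion keeps the first clique W explicit, as this is the choice
    that bounds the minimum over single removals.  The cardinality hypothesis
    makes the graph left after the last listed stage empty. *)
Lemma pi_path_bound A (l : seq {set T}) : 0 <= eps ->
  path (is_pi e) A l -> (#|A| <= (size l).+1)%N ->
  exists2 W, largest_clique e A W &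
    (capped_clique_number e eps A + ((opinion_index e eps (A :\: W))%:R)%:E
     <= \sum_(B <- A :: l) capped_clique_number e eps B)%E.
Proof.
move=> eps0; elim: l A => [|B l IHl] A /=.
  move=> _ A1; have [W lW] := largest_clique_exists e A.
  exists W => //; have := card_largest_cliqueD lW A1.
  rewrite leqn0 cards_eq0 => /eqP->.
  by rewrite opinion_index0 big_seq1 adde0.
case/andP=> /is_piP[W lW ->] l_pi /(card_largest_cliqueD lW) B_le.
have [W' lW' le_sum] := IHl _ l_pi B_le.
exists W => //; rewrite big_cons leeD2l //.
exact: le_trans (opinion_index_le_pi eps0 lW') le_sum.
Qed.

End Index.

Local Open Scope ereal_scope.

Theorem theorem1p5 (R : realType) (T : finType) (e : rel T)
    (e_sym : symmetric e) (e_irr : irreflexive e)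
    (e_conn : connected_graph e) (eps : R) (eps01 : (0 <= eps <= 1)%R) :
  ((opinion_index e eps [set: T])%:R)%:E
    <= \big[Order.min/+oo]_(W : {set T} | largest_clique e [set: T] W)
         (capped_clique_number e eps [set: T]
          + ((opinion_index e eps ([set: T] :\: W))%:R)%:E)
  /\
  \big[Order.min/+oo]_(W : {set T} | largest_clique e [set: T] W)
      (capped_clique_number e eps [set: T]
       + ((opinion_index e eps ([set: T] :\: W))%:R)%:E)
    <= \big[Order.min/+oo]_(s : {ffun 'I_#|T| -> {set T}} | is_pi_seq e s)
         \sum_(i < #|T|) capped_clique_number e eps (s i).
Proof.
have /andP[eps0 _] := eps01; split.
  by apply: le_bigmin => [|W lW]; rewrite ?leey // opinion_index_le_pi.
apply: le_bigmin => [|s s_pi]; first by rewrite leey.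
have sum_codom : \sum_(i < #|T|) capped_clique_number e eps (s i) =
    \sum_(B <- codom s) capped_clique_number e eps B.
  by rewrite big_map big_enum.
have s_path := is_pi_seq_sorted s_pi.
have size_s : size (codom s) = #|T| by rewrite size_codom card_ord.
rewrite sum_codom; case def_s: (codom s) s_path size_s => [|A l] /=.
  (* Here T is empty: removing the empty clique leaves both sides zero. *)
  move=> _ T0; have [W lW] := largest_clique_exists e [set: T].
  have all0 (A : {set T}) : A = set0.
    by apply/eqP; rewrite -cards_eq0 -leqn0 T0 max_card.
  apply: bigmin_inf lW _.
  rewrite (all0 (_ :\: W)) opinion_index0 adde0 big_nil ge_min.
  rewrite lee_fin lern0 -leqn0; apply/orP; left.
  by apply/bigmax_leqP => B _; rewrite (all0 B) cards0.
move=> s_path size_l.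
have A_T : A = [set: T].
  have T_gt0 : (0 < #|T|)%N by rewrite -size_l.
  have /andP[/forallP/(_ (Ordinal T_gt0))/eqP <- _] := s_pi.
  rewrite -[A]/(nth set0 (A :: l) (Ordinal T_gt0)) -def_s.
  by rewrite (nth_map (Ordinal T_gt0)) ?size_enum_ord ?nth_ord_enum.
have A_le : (#|A| <= (size l).+1)%N by rewrite size_l max_card.
have [W lW le_sum] := pi_path_bound eps0 s_path A_le.
rewrite A_T in lW le_sum *; exact: bigmin_inf lW le_sum.
Qed.
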